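(* Let $X$ be a convex domain equipped with a proximal setup (norm $\|\cdot\|$, distance-generating function $\omega$, Bregman distance $V$, prox-mapping $\mathrm{Prox}$, $\omega$-center $x_\omega$). Let $T\ge 1$ and let $f_t:X\to\mathbb{R}$, $t\in[T]$, be loss functions such that, for some $\alpha>0$ independent of $t$, every function $f_t(x)-\alpha\,\omega(x)$ is convex, or equivalently $$f_t(x)\le f_t(x')+\langle\nabla f_t(x),x-x'\rangle-\alpha V_x(x')\qquad\text{for all }x,x'\in X,\ t\in[T],$$ and such that there is $G\in(0,\infty)$ with $\|\nabla f_t(x)\|_*\le G$ for all $x\in X$, $t\in[T]$. Fix the convex combination weights $\theta_t=\frac{2t}{T(T+1)}$, $t\in[T]$, and generate $x_1:=x_\omega$ and $x_{t+1}:=\mathrm{Prox}_{x_t}(\gamma_t\nabla f_t(x_t))$ with step sizes $\gamma_t=\frac{2}{\alpha(t+1)}$ for $t\in[T]$. Then $$\sum_{t=1}^{T}\theta_t f_t(x_t)-\inf_{x\in X}\sum_{t=1}^{T}\theta_t f_t(x)\ \le\ \sup_{x\in X}\sum_{t=1}^{T}\theta_t\left(\langle\nabla f_t(x_t),x_t-x\rangle-\alpha V_{x_t}(x)\right)\ \le\ \frac{2G^2}{\alpha\,(T+1)}.$$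
   Context: $[T]=\{1,\dots,T\}$. $\nabla f_t(x)$ denotes a (selected) subgradient of $f_t$ at $x$ (the gradient if differentiable). Proximal setup for a convex domain $Z$ in a Euclidean space $E$ (here $Z=X$): (i) a norm $\|\cdot\|$ on $E$ with dual norm $\|\zeta\|_*=\max_{\|z\|\le 1}\langle\zeta,z\rangle$; (ii) a distance-generating function $\omega:Z\to\mathbb{R}$, convex and continuous on $Z$, admitting a selection of subgradients $\nabla\omega(z)$ that is continuous on $Z^\circ:=\{z\in Z:\partial\omega(z)\ne\emptyset\}$, and strongly convex with modulus 1: $\langle\nabla\omega(z')-\nabla\omega(z''),z'-z''\rangle\ge\|z'-z''\|^2$ for all $z',z''\in Z^\circ$; (iii) Bregman distance $V_z(z'):=\omega(z')-\omega(z)-\langle\nabla\omega(z),z'-z\rangle$ for $z\in Z^\circ$, $z'\in Z$; (iv) prox-mapping $\mathrm{Prox}_z(\xi):=\arg\min_{z'\in Z}\{\langle\xi,z'\rangle+V_z(z')\}$, a map $E\to Z^\circ$, for $z\in Z^\circ$; (v) $\omega$-center $z_\omega:=\arg\min_{z\in Z}\omega(z)$; (vi) set width $\Omega:=\max_{z\in Z}V_{z_\omega}(z)$. Existence of these minimizers and of the maximum is part of the setup. *)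

(* Defs.v *)
(* The Euclidean space E is 'rV[R]_n with an arbitrary inner product
   ip : {dot 'rV[R]_n for idfun}; its canonical topology is that of any norm,
   since the dimension is finite.  A function on a subset X of E is represented
   by a total function of which only the values on X matter. *)
From mathcomp Require Import all_boot all_order all_algebra.
From mathcomp Require Import all_classical all_reals all_analysis.
Import numFieldNormedType.Exports.

Set Implicit Arguments.
Unset Strict Implicit.
Unset Printing Implicit Defensive.

Import Order.TTheory GRing.Theory Num.Theory.

Local Open Scope classical_set_scope.
Local Open Scope ring_scope.

Section ProximalSetup.
Variables (R : realType) (n : nat).
Local Notation E := 'rV[R]_n.
Variable ip : {dot E for (@idfun R)}.

Record is_norm (N : E -> R) : Prop := IsNorm {
  is_norm_triangle : forall x y, N (x + y) <= N x + N y;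
  is_norm_homog : forall a x, N (a *: x) = `|a| * N x;
  is_norm_eq0 : forall x, N x = 0 -> x = 0
}.

(* Extended-real valued, so that no boundedness side condition is needed; the
   supremum is in fact a maximum because E is finite dimensional. *)
Definition dual_norm (N : E -> R) (zeta : E) : \bar R :=
  ereal_sup [set (ip zeta z)%:E | z in [set z | N z <= 1]].

(* For a point x of X: h is regarded as +oo outside X. *)
Definition subgradient (X : set E) (h : E -> R) (x g : E) : Prop :=
  forall y, X y -> h x + ip g (y - x) <= h y.

Definition subdifferentiable_points (X : set E) (h : E -> R) : set E :=
  [set x | X x /\ exists g, subgradient X h x g].

Definition argmin_on (X : set E) (h : E -> R) (x : E) : Prop :=
  X x /\ forall y, X y -> h x <= h y.

Definition bregman (omega : E -> R) (nabla : E -> E) (z z' : E) : R :=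
  omega z' - omega z - ip (nabla z) (z' - z).

(* subdifferentiable_points X dgf is the set usually written X^o. *)
Record proximal_setup (X : set E) := ProximalSetup {
  pnorm : E -> R;
  dgf : E -> R;
  dgf_grad : E -> E;
  dgf_center : E;
  prox : E -> E -> E;
  width : R;
  pnormP : is_norm pnorm;
  dgf_convex : convex_function X dgf;
  dgf_continuous : {within X, continuous dgf};
  dgf_gradP : forall z, subdifferentiable_points X dgf z ->
    subgradient X dgf z (dgf_grad z);
  dgf_grad_continuous :
    {within subdifferentiable_points X dgf, continuous dgf_grad};
  dgf_strong : forall z z', subdifferentiable_points X dgf z ->
    subdifferentiable_points X dgf z' ->
    pnorm (z - z') ^+ 2 <= ip (dgf_grad z - dgf_grad z') (z - z');
  dgf_centerP : argmin_on X dgf dgf_center;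
  proxP : forall z xi, subdifferentiable_points X dgf z ->
    subdifferentiable_points X dgf (prox z xi) /\
    argmin_on X (fun z' => ip xi z' + bregman dgf dgf_grad z z') (prox z xi);
  widthP : (exists2 z, X z & bregman dgf dgf_grad dgf_center z = width) /\
    (forall z, X z -> bregman dgf dgf_grad dgf_center z <= width)
}.

Definition setup_bregman (X : set E) (S : proximal_setup X) : E -> E -> R :=
  bregman (dgf S) (dgf_grad S).

End ProximalSetup.

(* Main.v *)
Require Import Defs.
From mathcomp Require Import all_boot all_order all_algebra.
From mathcomp Require Import all_classical all_reals all_analysis.
From mathcomp Require Import ring lra.
Import numFieldNormedType.Exports.
Import Order.TTheory GRing.Theory Num.Theory.
Local Open Scope classical_set_scope.
Local Open Scope ring_scope.

Set Implicit Arguments.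
Unset Strict Implicit.
Unset Printing Implicit Defensive.

(** The proof is mirror descent with weights chosen so that the Bregman terms
telescope.  Write V for the Bregman distance, g for the selected gradient of
the distance-generating function omega, and Xo for the set of points where
omega has a subgradient.

Second inequality.  The optimality condition of the prox-mapping at the step
from x_t to x_(t+1), together with V_x(y) >= |y - x|^2 / 2 and Young's
inequality, gives
  gamma_t <grad f_t(x_t), x_t - y>
    <= V_(x_t)(y) - V_(x_(t+1))(y) + gamma_t^2 G^2 / 2
([prox_step]).  Multiplied by theta_t / gamma_t = k t (t + 1), where
k = alpha / (T (T + 1)), and combined with - theta_t alpha V_(x_t)(y), which is
- 2 k t V_(x_t)(y), the Bregman part becomes
k (t (t - 1) V_(x_t)(y) - (t + 1) t V_(x_(t+1))(y)), which telescopes and starts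
from 0; each of the T error terms is at most 2 G^2 / (alpha T (T + 1))
([weighted_step_telescopes]).

First inequality.  It is the sum over t, with weights theta_t, of
  f_t(x_t) - f_t(y) <= <grad f_t(x_t), x_t - y> - alpha V_(x_t)(y)
([relative_strong_convexity_bound]).

The delicate point behind both is that omega need not be differentiable: at a
point x of Xo on the relative boundary of X it has many subgradients, and V
uses the selected one.  An optimality condition, or the convexity of
f_t - alpha omega, only involves some subgradient.  What makes the selection
the right one is its continuity: if w is in the relative interior of X, then
the half-open segment from x to w (without x) lies in Xo, and a subgradient
inequality of omega at x + s (w - x), divided by s, shows as s tends to 0 that
the derivative of omega at x in direction w - x is <g(x), w - x>.
Hence, for h convex and beta >= 0, every subgradient of h + beta omega at x
becomes a subgradient of h when beta g(x) is subtracted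
([subgradient_sub_dgf]).  With h = 0 this is the optimality condition of the
prox-mapping; with h = f_t - alpha omega it is the lower bound for f_t.

This argument needs relative interior points to exist, to be dense in X along
segments, and to carry subgradients of convex functions.  These facts are
proved in the algebraic form of [relative_core]: existence by maximizing the
dimension of a space of two-sided feasible directions, subgradients by
extending a supporting functional one coordinate at a time. *)

(** * Inner products *)

Section InnerProduct.
Variables (R : realType) (n : nat) (ip : {dot 'rV[R]_n for (@idfun R)}).
Implicit Types u v w : 'rV[R]_n.

Lemma ipC u v : ip u v = ip v u.
Proof. by rewrite hermC /= expr0 mul1r. Qed.

Lemma ipDl u v w : ip (u + v) w = ip u w + ip v w.
Proof. by rewrite linearDl. Qed.

Lemma ipBl u v w : ip (u - v) w = ip u w - ip v w.
Proof. by rewrite linearBl. Qed.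

Lemma ipZl a u w : ip (a *: u) w = a * ip u w.
Proof. by rewrite linearZl_LR. Qed.

Lemma ipDr u v w : ip u (v + w) = ip u v + ip u w.
Proof. by rewrite linearDr. Qed.

Lemma ipBr u v w : ip u (v - w) = ip u v - ip u w.
Proof. by rewrite linearBr. Qed.

Lemma ipNr u v : ip u (- v) = - ip u v.
Proof. by rewrite linearNr. Qed.

Lemma ipZr a u w : ip u (a *: w) = a * ip u w.
Proof. by rewrite ipC ipZl ipC. Qed.

Lemma ip_sum_delta u v : ip u v = \sum_i u 0 i * ip (delta_mx 0 i) v.
Proof.
rewrite ipC [in LHS](row_sum_delta u) linear_sum /=.
by apply: eq_bigr => i _; rewrite ipZr ipC.
Qed.

Lemma ip_eq0 u : ip u u = 0 -> u = 0.
Proof.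
move=> uu0; apply: contra_eq uu0 => /(neq0_dnorm_gt0 (s := ip)).
by rewrite lt0r => /andP[].
Qed.

(** The Gram matrix of a definite form is invertible. This lets supporting
functionals be built coordinate by coordinate and still be inner products. *)
Lemma ip_coord (i : 'I_n) : exists g, forall d, ip g d = d 0 i.
Proof.
pose B : 'M[R]_n := \matrix_(i, j) ip (delta_mx 0 i) (delta_mx 0 j).
have BE (g : 'rV_n) j : (g *m B) 0 j = ip g (delta_mx 0 j).
  by rewrite mxE ip_sum_delta; apply: eq_bigr => l _; rewrite mxE.
have ipE (g d : 'rV_n) : ip g d = \sum_j (g *m B) 0 j * d 0 j.
  by rewrite ipC ip_sum_delta; apply: eq_bigr => j _; rewrite BE ipC mulrC.
have Bunit : B \in unitmx.
  rewrite -row_free_unit -kermx_eq0; apply/rowV0P => g /sub_kermxP gB0.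
  by apply: ip_eq0; rewrite ipE gB0 big1 // => j _; rewrite mxE mul0r.
exists (delta_mx 0 i *m invmx B) => d; rewrite ipE mulmxKV // (bigD1 i) //=.
rewrite mxE !eqxx mul1r big1 ?addr0 // => j /negPf ji.
by rewrite mxE ji andbF mul0r.
Qed.

Lemma ip_continuousl d : continuous (fun v : 'rV[R]_n => ip v d).
Proof.
under eq_fun do rewrite ip_sum_delta.
apply: continuous_big; first by move=> z; apply: cvgD;
  [exact: cvg_fst | exact: cvg_snd].
move=> i _ v; apply: cvgMr_tmp; first exact: nbhs_filter.
exact: coord_continuous.
Qed.

End InnerProduct.

(** * Limits and separation on the real line *)

Section Limits.
Variable R : realType.
Implicit Types a b c : R.

Lemma ler_affine_limit a b c :
  (forall s, 0 < s -> s <= 1 -> a <= b + s * c) -> a <= b.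
Proof.
move=> ab; apply/ler_addgt0Pr => e e0.
have c0 : 0 < 1 + `|c| by rewrite ltr_pwDl.
pose s := Num.min 1 (e / (1 + `|c|)).
have s0 : 0 < s by rewrite lt_min ltr01 divr_gt0.
apply: (le_trans (ab s s0 _)); first by rewrite ge_min lexx.
rewrite lerD2l (le_trans (ler_norm _)) // normrM gtr0_norm //.
apply: (@le_trans _ _ (e / (1 + `|c|) * `|c|)).
  by rewrite ler_wpM2r // ge_min lexx orbT.
rewrite mulrAC ler_pdivrMr // ler_wpM2l ?ltW //; lra.
Qed.

(** When one of the sets is empty the other one is required to be empty too:
without this the nonempty one could be unbounded on the relevant side. *)
Lemma real_separation (A B : set R) :
  (A !=set0 <-> B !=set0) -> (forall a b, A a -> B b -> a <= b) ->
  exists c, (forall a, A a -> a <= c) /\ (forall b, B b -> c <= b).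
Proof.
move=> AB leAB; have [A0|A0] := pselect (A !=set0); last first.
  exists 0; split=> [a Aa|b Bb]; first by case: A0; exists a.
  by case: A0; apply/AB; exists b.
have /AB[b0 Bb0] := A0.
exists (sup A); split=> [a Aa|b Bb]; last first.
  by apply: ge_sup => // a Aa; exact: leAB.
by apply: ub_le_sup => //; exists b0 => x Ax; exact: leAB.
Qed.

End Limits.

(** * Segments in convex sets *)

Section ConvexSegments.
Variables (R : realType) (n : nat) (X : set 'rV[R]_n).
Implicit Types x y : 'rV[R]_n.
Implicit Types t : R.

Lemma segment_conv x y t : 0 <= t -> t <= 1 -> exists2 l : {i01 R},
  l%:num = t & x + t *: (y - x) = conv l (y : convex_lmodType _) x.
Proof.
move=> t0 t1.
have t01 : Itv.spec (@Itv.num_sem R) (Itv.Real `[0%Z, 1%Z]) t.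
  by rewrite /= /Itv.num_sem /= ger0_real //= in_itv /= t0.
exists (Itv.mk t01) => //.
by apply/rowP => i; rewrite !mxE /= /unstable.onem; ring.
Qed.

Lemma convex_set_segment x y t : convex_set X -> X x -> X y -> 0 <= t ->
  t <= 1 -> X (x + t *: (y - x)).
Proof.
move=> X_convex Xx Xy t0 t1; have [l _ ->] := segment_conv x y t0 t1.
exact/set_mem/(X_convex _ _ l (mem_set Xy) (mem_set Xx)).
Qed.

Lemma convex_function_segment (h : 'rV[R]_n -> R) x y t :
  convex_function X h -> X x -> X y -> 0 <= t -> t <= 1 ->
  h (x + t *: (y - x)) <= h x + t * (h y - h x).
Proof.
move=> hc Xx Xy t0 t1; have [l lt ->] := segment_conv x y t0 t1.
apply: (le_trans (hc l _ _ (mem_set Xy) (mem_set Xx))).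
by rewrite convRE /= lt /unstable.onem; lra.
Qed.

End ConvexSegments.

(** * Relative interior points of convex sets *)

Section RelativeCore.
Variables (R : realType) (n : nat) (X : set 'rV[R]_n).
Hypothesis X_convex : convex_set X.
Implicit Types x y w d : 'rV[R]_n.
Implicit Types s t : R.

Definition two_sided w d : Prop :=
  exists2 t, 0 < t & X (w + t *: d) /\ X (w - t *: d).

(** In finite dimension these are exactly the relative interior points of a
convex set. Feasible directions replace the topology of the affine hull, so
that membership is checked on one line through w at a time. *)
Definition relative_core : set 'rV[R]_n :=
  [set w | X w /\ forall y, X y -> two_sided w (y - w)].

Lemma convex_set_shrink w d s t : X w -> X (w + t *: d) -> 0 < t ->
  0 <= s -> s <= t -> X (w + s *: d).
Proof.
move=> Xw Xwd t0 s0 st.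
have -> : w + s *: d = w + (s / t) *: (w + t *: d - w).
  by rewrite addrAC subrr add0r scalerA mulfVK ?gt_eqF.
apply: convex_set_segment => //; first by rewrite divr_ge0 // ltW.
by rewrite ler_pdivrMr // mul1r.
Qed.

(** At the midpoint of w and y, feasible directions at w and the direction y - w
combine: the part along y - w changes the coefficient of y from 1/2 to
l = 1/2 + s c, and what is left, of weight 1 - l >= 1/4, absorbs a step along a
of length at most 4 s at w. *)
Lemma convex_set_midpoint_move w y a c s t :
  X w -> X y -> X (w + t *: a) -> 0 < s -> 4 * s <= t -> 4 * s * `|c| <= 1 ->
  X (w + 2^-1 *: (y - w) + s *: (a + c *: (y - w))).
Proof.
move=> Xw Xy Xwa s0 st sc.
have /andP[c1 c2] : - 1 <= 4 * s * c <= 1.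
  by rewrite -ler_norml normrM gtr0_norm ?mulr_gt0.
pose l := 2^-1 + s * c.
have l1 : 4^-1 <= 1 - l by rewrite /l; lra.
have l0 : 0 < 1 - l by lra.
set p := w + 2^-1 *: _ + _.
have -> : p = w + (s / (1 - l)) *: a + l *: (y - (w + (s / (1 - l)) *: a)).
  apply/rowP => i; rewrite /p /l !mxE; field.
  by rewrite -/l; lra.
apply: convex_set_segment => //; [|rewrite /l; lra..].
apply: (convex_set_shrink Xw Xwa); first lra.
  by rewrite divr_ge0 // ltW.
rewrite ler_pdivrMr //; apply: (le_trans _ (ler_wpM2l _ l1)); lra.
Qed.

(** Take w in X and a linear space of two-sided feasible directions at w, of the
largest possible dimension. If y - w were outside this space for some y in X,
the midpoint of w and y would have all of its directions and y - w as well. *)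
Lemma relative_core_nonempty : X !=set0 -> relative_core !=set0.
Proof.
move=> [x0 Xx0].
pose P k := exists w (A : 'M[R]_n),
  [/\ X w, \rank A = k & forall d, (d <= A)%MS -> two_sided w d].
have exP : exists k, `[<P k>].
  exists 0%N; apply/asboolP; exists x0, 0; split=> //; first exact: mxrank0.
  move=> d; rewrite submx0 => /eqP ->; exists 1 => //.
  by rewrite scaler0 subr0 addr0.
have leP k : `[<P k>] -> (k <= n)%N.
  by move=> /asboolP[w [A [_ <- _]]]; exact: rank_leq_row.
case: (ex_maxnP exP leP) => k /asboolP[w [A [Xw rA wA]]] kmax.
exists w; split=> // y Xy; apply: (wA).
apply/negPn/negP => yA.
have AV : (k < \rank (A + (y - w)%R)%MS)%N.
  rewrite -rA; apply: rank_ltmx; rewrite ltmxE addsmxSl.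
  by apply: contra yA; apply: submx_trans; exact: addsmxSr.
suff /asboolP/kmax : P (\rank (A + (y - w)%R)%MS) by rewrite leqNgt AV.
exists (w + 2^-1 *: (y - w)), (A + (y - w)%R)%MS; split=> //.
  by apply: convex_set_segment => //; lra.
move=> d /sub_addsmxP[[u1 u2] /= dE].
pose a := u1 *m A; pose c := u2 0 0.
have {}dE : d = a + c *: (y - w) by rewrite dE [u2]mx11_scalar mul_scalar_mx.
have [t t0 [Xt1 Xt2]] := wA a (submxMl _ _).
(* small enough for convex_set_midpoint_move, in both directions *)
pose s := Num.min (t / 4) (4 * (1 + `|c|))^-1.
have c0 : 0 < 1 + `|c| by rewrite ltr_pwDl.
have s0 : 0 < s by rewrite lt_min divr_gt0 //= invr_gt0 mulr_gt0.
have st : 4 * s <= t.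
  by rewrite mulrC -ler_pdivlMr // ge_min lexx.
have sc : 4 * s * `|c| <= 1.
  apply: (@le_trans _ _ (s * (4 * (1 + `|c|)))); first by nra.
  by rewrite -ler_pdivlMr ?mulr_gt0 // mul1r ge_min lexx orbT.
exists s => //; split; rewrite dE.
  exact: (convex_set_midpoint_move (t := t)).
have -> (z : 'rV[R]_n) : z - s *: (a + c *: (y - w)) =
    z + s *: (- a + (- c) *: (y - w)).
  by rewrite scaleNr -opprD scalerN.
by apply: (convex_set_midpoint_move (t := t)); rewrite ?scalerN ?normrN.
Qed.

(** Let q = w - s' (y - w) be a point of X beyond w. Moving away from y from the
point u + s (w - u) stays, for small steps t, on the segment from u to such a
point q, at the parameter r = s - t (1 - s); the overshoot needed is s' = t / r. *)
Lemma relative_core_segment w u s : relative_core w -> X u -> 0 < s -> s <= 1 ->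
  relative_core (u + s *: (w - u)).
Proof.
move=> [Xw wcore] Xu s0 s1; have Xv : X (u + s *: (w - u)).
  by apply: convex_set_segment; rewrite // ltW.
split=> // y Xy; have [t0 t00 [_ Xt0]] := wcore y Xy.
pose t1 := Num.min t0 1; have t10 : 0 < t1 by rewrite lt_min t00 ltr01.
have t1t0 : t1 <= t0 by rewrite ge_min lexx.
have t11 : t1 <= 1 by rewrite ge_min lexx orbT.
(* gives r >= s / 2, hence t / r <= t1 <= t0 *)
pose t := s * t1 / 2; pose r := s - t * (1 - s).
have st1 : s * t1 <= s by rewrite ger_pMr.
have t_gt0 : 0 < t by rewrite divr_gt0 // mulr_gt0.
have rs : s / 2 <= r by rewrite /r; have : t <= s / 2 by [rewrite /t; lra]; nra.
have r0 : 0 < r by lra.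
have t_le1 : t <= 1 by rewrite /t; lra.
exists t => //; split; first by apply: convex_set_segment => //; rewrite ltW.
set p := _ - _.
have -> : p = u + r *: (w + (t / r) *: (- (y - w)) - u).
  apply/rowP => i; rewrite /p !mxE.
  have tE : r * (t / r) = t by rewrite mulrC mulfVK ?gt_eqF.
  rewrite !mulrDr mulrA tE /r; ring.
apply: convex_set_segment => //; [|by rewrite ltW|rewrite /r; nra].
rewrite -scalerN in Xt0.
apply: (convex_set_shrink Xw Xt0) => //; first by rewrite divr_ge0 // ltW.
rewrite ler_pdivrMr //; apply: (@le_trans _ _ (t1 * r)); first by rewrite /t; nra.
by rewrite ler_wpM2r // ltW.
Qed.

End RelativeCore.

(** * Subgradients at relative interior points *)

Section Subdifferentiability.
Variables (R : realType) (n : nat) (ip : {dot 'rV[R]_n for (@idfun R)}).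
Variable X : set 'rV[R]_n.
Hypothesis X_convex : convex_set X.
Implicit Types (h : 'rV[R]_n -> R) (x y w d g : 'rV[R]_n).

(** Hahn-Banach extension by one coordinate at a time. The slice consists of the
points that agree with w from coordinate k on. In passing from k to k + 1, the
missing coefficient has to lie above all slopes at points with y_k < w_k and
below all slopes at points with y_k > w_k; convexity compares a pair of such
points at the point between them whose coordinate k is w_k. Since w is in the
relative core, points of both kinds exist as soon as points of one kind do. *)
Lemma relative_core_subgradient_slice h w k : convex_function X h ->
  relative_core X w -> (k <= n)%N ->
  exists g, forall y, X y -> (forall j : 'I_n, (k <= j)%N -> y 0 j = w 0 j) ->
    h w + ip g (y - w) <= h y.
Proof.
move=> hcvx [Xw wcore]; elim: k => [_|k IHk kn].
  exists 0 => y _ yw; have -> : y = w by apply/rowP => j; exact: yw.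
  by rewrite subrr linear0r addr0.
have [g gP] := IHk (ltnW kn); pose e := Ordinal kn.
have [u uP] := ip_coord ip e.
pose slice y := X y /\ forall j : 'I_n, (k < j)%N -> y 0 j = w 0 j.
pose rise y := h y - h w - ip g (y - w).
pose slope y := rise y / (y 0 e - w 0 e).
pose L := [set r | exists y, [/\ slice y, y 0 e < w 0 e & r = slope y]].
pose U := [set r | exists y, [/\ slice y, w 0 e < y 0 e & r = slope y]].
have LU : L !=set0 <-> U !=set0.
  have opposite y : slice y -> exists2 t, 0 < t & slice (w - t *: (y - w)).
    move=> [Xy yw]; have [t t0 [_ Xt]] := wcore y Xy; exists t => //; split=> //.
    by move=> j kj; rewrite !mxE yw // subrr mulr0 subr0.
  split=> -[_ [y [sy ye _]]]; have [t t0 st] := opposite y sy;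
    exists (slope (w - t *: (y - w))); exists (w - t *: (y - w)); split=> //;
    rewrite !mxE ?gtrDl ?ltrDl ?oppr_lt0 ?oppr_gt0.
    by rewrite pmulr_rlt0 // subr_lt0.
  by rewrite pmulr_rgt0 // subr_gt0.
have leLU a b : L a -> U b -> a <= b.
  move=> [y [[Xy yw] ye ->]] [z [[Xz zw] ze ->]].
  pose p := w 0 e - y 0 e; pose q := z 0 e - w 0 e.
  have p0 : 0 < p by rewrite subr_gt0.
  have q0 : 0 < q by rewrite subr_gt0.
  pose l := p / (p + q).
  have pq_gt0 : 0 < p + q by exact: addr_gt0.
  have pq0 : p + q != 0 by rewrite gt_eqF.
  have l0 : 0 <= l by rewrite divr_ge0 // ltW.
  have l1 : l <= 1 by rewrite ler_pdivrMr // mul1r lerDl ltW.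
  have Xc := convex_set_segment X_convex Xy Xz l0 l1.
  have c_slice (j : 'I_n) : (k <= j)%N -> (y + l *: (z - y)) 0 j = w 0 j.
    rewrite leq_eqVlt => /orP[/eqP kj|kj]; rewrite !mxE; last first.
      by rewrite yw // zw // subrr mulr0 addr0.
    have -> : j = e by exact/val_inj.
    rewrite (_ : z 0 e - y 0 e = p + q); last by rewrite /p /q; ring.
    by rewrite /l mulfVK // /p addrCA subrr addr0.
  have := le_trans (gP _ Xc c_slice)
    (convex_function_segment hcvx Xy Xz l0 l1).
  have -> : y + l *: (z - y) - w = (y - w) + l *: ((z - w) - (y - w)).
    by apply/rowP => j; rewrite !mxE; ring.
  rewrite ipDr ipZr ipBr => h_ge.
  have {h_ge} : 0 <= (1 - l) * rise y + l * rise z by rewrite /rise; lra.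
  have -> : 1 - l = q / (p + q) by rewrite /l; field.
  rewrite /l -2!mulrA ![_^-1 * _]mulrC !mulrA -mulrDl pmulr_lge0 ?invr_gt0 //.
  rewrite /slope -[y 0 e - w 0 e]opprB -/p -/q invrN mulrN => pos.
  rewrite ler_pdivlMr // -mulNr mulrAC ler_pdivrMr //; lra.
have [b [Lb Ub]] := real_separation LU leLU.
exists (g + b *: u) => y Xy yw; rewrite ipDl ipZl uP !mxE addrA.
have sy : slice y by split=> // j kj; exact/yw/ltnW.
have [ye|ye|ye] := ltgtP (y 0 e) (w 0 e).
- have := Lb (slope y); rewrite /slope ler_ndivrMr ?subr_lt0 // => /(_ _) bP.
  rewrite -lerBrDl; apply: (le_trans (bP _)); first by exists y.
  by rewrite /rise; lra.
- have := Ub (slope y); rewrite /slope ler_pdivlMr ?subr_gt0 // => /(_ _) bP.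
  rewrite -lerBrDl; apply: (le_trans (bP _)); first by exists y.
  by rewrite /rise; lra.
- rewrite ye subrr mulr0 addr0; apply: gP => // j.
  rewrite leq_eqVlt => /orP[/eqP kj|kj]; last exact: (proj2 sy).
  by have -> : j = e by exact/val_inj.
Qed.

Lemma relative_core_subdifferentiable h : convex_function X h ->
  relative_core X `<=` subdifferentiable_points ip X h.
Proof.
move=> hcvx w wcore; split; first exact: (proj1 wcore).
have [g gP] := relative_core_subgradient_slice hcvx wcore (leqnn n).
by exists g => y Xy; apply: gP => // j; rewrite leqNgt ltn_ord.
Qed.

End Subdifferentiability.

(** * Norms and their duals *)

Section NormFacts.
Variables (R : realType) (n : nat) (ip : {dot 'rV[R]_n for (@idfun R)}).
Variable N : 'rV[R]_n -> R.
Hypothesis N_norm : is_norm N.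

Lemma is_normN v : N (- v) = N v.
Proof. by rewrite -scaleN1r (is_norm_homog N_norm) normrN1 mul1r. Qed.

Lemma is_norm0 : N 0 = 0.
Proof. by rewrite -(scale0r 0) (is_norm_homog N_norm) normr0 mul0r. Qed.

Lemma is_norm_ge0 v : 0 <= N v.
Proof.
by have := is_norm_triangle N_norm v (- v); rewrite subrr is_norm0 is_normN; lra.
Qed.

Lemma ip_le_dual_norm G zeta v :
  (dual_norm ip N zeta <= G%:E)%E -> ip zeta v <= G * N v.
Proof.
move=> zG; have [Nv0|Nv0] := eqVneq (N v) 0.
  by rewrite Nv0 mulr0 (is_norm_eq0 N_norm Nv0) linear0r.
have Nv_gt0 : 0 < N v by rewrite lt0r Nv0 is_norm_ge0.
have Nunit : N ((N v)^-1 *: v) <= 1.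
  by rewrite (is_norm_homog N_norm) ger0_norm ?invr_ge0 ?is_norm_ge0 // mulVf.
have : ((ip zeta ((N v)^-1 *: v))%:E <= G%:E)%E.
  apply: le_trans zG; apply: ereal_sup_ubound.
  by exists ((N v)^-1 *: v).
by rewrite lee_fin ipZr mulrC ler_pdivrMr.
Qed.

End NormFacts.

(** * Bregman distances and prox-mappings *)

Section ProximalGeometry.
Variables (R : realType) (n : nat) (ip : {dot 'rV[R]_n for (@idfun R)}).
Variables (X : set 'rV[R]_n) (ps : proximal_setup ip X).
Hypothesis X_convex : convex_set X.
Implicit Types (h : 'rV[R]_n -> R) (x y w p : 'rV[R]_n).
Implicit Types e s alpha beta gamma G : R.

Local Notation omega := (dgf ps).
Local Notation g := (dgf_grad ps).
Local Notation Xo := (subdifferentiable_points ip X (dgf ps)).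
Local Notation N := (pnorm ps).
Local Notation V := (setup_bregman ps).

Lemma segment_to_core_subdifferentiable x w s :
  X x -> relative_core X w -> 0 < s -> s <= 1 -> Xo (x + s *: (w - x)).
Proof.
move=> Xx wcore s0 s1.
apply: (relative_core_subdifferentiable ip X_convex (dgf_convex ps)).
exact: relative_core_segment.
Qed.

(** Segments towards the relative core stay in the domain of the selection, so its
continuity there can be used at x, even if x is on the relative boundary. *)
Lemma dgf_grad_segment_limit x w e :
  Xo x -> relative_core X w -> 0 < e ->
  exists s, [/\ 0 < s, s <= 1 &
    ip (g (x + s *: (w - x))) (w - x) <= ip (g x) (w - x) + e].
Proof.
move=> Xox wcore e0; pose d := w - x.
have gcont : (fun y => ip (g y) d) @ within Xo (nbhs x) --> ip (g x) d.
  apply: (@continuous_cvg _ _ _ _ _ _ (fun v => ip v d)).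
    exact: ip_continuousl.
  by have /subspace_continuousP := @dgf_grad_continuous _ _ _ _ ps; apply.
have /nbhs_ballP[r /= r0 rP] : nbhs x [set y | Xo y -> ip (g y) d <= ip (g x) d + e].
  have /gcont : nbhs (ip (g x) d) [set v | v <= ip (g x) d + e].
    apply/nbhs_ballP; exists e => //= v.
    by rewrite /ball /= ltr_distlC => /andP[_ /ltW].
  by [].
have d0 : 0 < 1 + `|d| by rewrite ltr_pwDl.
pose s := Num.min 1 (r / (2 * (1 + `|d|))).
have s0 : 0 < s by rewrite lt_min ltr01 divr_gt0 // mulr_gt0.
have s1 : s <= 1 by rewrite ge_min lexx.
exists s; split=> //; apply: rP; last first.
  by apply: segment_to_core_subdifferentiable => //; exact: (proj1 Xox).
rewrite -ball_normE /= opprD addrA subrr sub0r normrN normrZ gtr0_norm //.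
apply: (@le_lt_trans _ _ (r / (2 * (1 + `|d|)) * `|d|)).
  by rewrite ler_wpM2r // ge_min lexx orbT.
rewrite mulrAC ltr_pdivrMr ?mulr_gt0 //.
by have : 0 <= `|d| by []; nra.
Qed.

(** Along the segment from y to a core point, h lies below its chord, so the
inequality passes to the limit at y even if h jumps up there. *)
Lemma subgradient_from_core h x p : convex_function X h -> X x ->
  (forall y, relative_core X y -> h x + ip p (y - x) <= h y) ->
  subgradient ip X h x p.
Proof.
move=> hcvx Xx hp y Xy.
have [w wcore] : relative_core X !=set0.
  by apply: relative_core_nonempty => //; exists x.
apply: (@ler_affine_limit _ _ _ (h w - h y - ip p (w - y))) => s s0 s1.
have := le_trans (hp _ (relative_core_segment X_convex wcore Xy s0 s1))
  (convex_function_segment hcvx Xy (proj1 wcore) (ltW s0) s1).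
rewrite [y + _ - x]addrAC (ipDr _ _ _ (s *: _)) ipZr; lra.
Qed.

(** A priori p could owe part of its slope to a subgradient of omega other than the
selected one. On a segment towards a core point the growth of omega over a step s is at
most s times the selected slope at the end of the step, and that slope tends to
the selected slope at x: no subgradient of omega at x exceeds the selected one
in these directions. *)
Lemma subgradient_sub_dgf h beta x p : convex_function X h -> 0 <= beta ->
  Xo x -> subgradient ip X (fun y => h y + beta * omega y) x p ->
  subgradient ip X h x (p - beta *: g x).
Proof.
move=> hcvx beta0 Xox px; have Xx := proj1 Xox.
apply: subgradient_from_core => // y ycore.
apply/ler_addgt0Pr => e e0.
(* an error e / (beta + 1) in the slope of omega costs at most e *)
have e1 : 0 < e / (beta + 1) by rewrite divr_gt0 // ltr_wpDl.
have [s [s0 s1 gs]] := dgf_grad_segment_limit Xox ycore e1.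
have Xoq := segment_to_core_subdifferentiable Xx ycore s0 s1.
set q := x + s *: (y - x) in gs Xoq.
have qx : q - x = s *: (y - x) by rewrite /q addrAC subrr add0r.
have hq := convex_function_segment hcvx Xx (proj1 ycore) (ltW s0) s1.
have wq := dgf_gradP Xoq Xx; rewrite -opprB ipNr qx ipZr in wq.
have := px q (proj1 Xoq); rewrite qx ipZr => pq.
rewrite -/q in hq.
have hpy : ip p (y - x) <= (h y - h x) + beta * ip (g q) (y - x).
  rewrite -(ler_pM2l s0).
  have : beta * omega q <= beta * (omega x + s * ip (g q) (y - x)).
    by rewrite ler_wpM2l //; lra.
  lra.
have bgs := ler_wpM2l beta0 gs.
have be : beta * (e / (beta + 1)) <= e.
  by rewrite mulrCA ger_pMr // ler_pdivrMr ?ltr_wpDl // mul1r lerDl.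
by rewrite ipBl ipZl; lra.
Qed.

Lemma bregman_ge0 x y : Xo x -> X y -> 0 <= V x y.
Proof. by move=> Xox Xy; have := dgf_gradP Xox Xy; rewrite /V /bregman; lra. Qed.

Lemma bregman_split x y z :
  V x z = V x y + V y z + ip (g y - g x) (z - y).
Proof.
have -> : z - y = (z - x) - (y - x) by rewrite opprB addrA subrK.
rewrite /V /bregman ipBl.
have -> : z - y = (z - x) - (y - x) by rewrite opprB addrA subrK.
by rewrite !ipBr; ring.
Qed.

(** Bootstrapping by bisection. If V >= c |.|^2 on segments ending in the core,
splitting at the midpoint gives two terms c |y - x|^2 / 4 and, from strong
monotonicity of the gradient, a term |y - x|^2 / 4. Thus c improves to
c / 2 + 1 / 4, whose fixed point is 1 / 2, starting from c = 0 by convexity. *)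
Lemma bregman_core_growth k x y : Xo x -> relative_core X y ->
  (1 - (2 ^+ k)^-1) / 2 * N (y - x) ^+ 2 <= V x y.
Proof.
elim: k x y => [|k IHk] x y Xox ycore.
  by rewrite expr0 invr1 subrr !mul0r bregman_ge0 //; exact: (proj1 ycore).
pose m := x + 2^-1 *: (y - x).
have Xx := proj1 Xox.
have h0 : 0 < 2^-1 :> R by lra.
have h1 : 2^-1 <= 1 :> R by lra.
have mcore : relative_core X m by exact: relative_core_segment.
have Xom : Xo m by exact: segment_to_core_subdifferentiable.
have mx : m - x = 2^-1 *: (y - x) by rewrite /m addrAC subrr add0r.
have ym : y - m = 2^-1 *: (y - x).
  by apply/rowP => i; rewrite !mxE; field.
have Nhalf : N (2^-1 *: (y - x)) = 2^-1 * N (y - x).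
  by rewrite (is_norm_homog (pnormP ps)) ger0_norm ?ltW.
have Vxm := IHk _ _ Xox mcore; rewrite mx Nhalf in Vxm.
have Vmy := IHk _ _ Xom ycore; rewrite ym Nhalf in Vmy.
have := dgf_strong Xom Xox; rewrite mx Nhalf => strong.
rewrite (bregman_split x m y) ym.
rewrite exprS invfM; lra.
Qed.

Lemma bregman_growth x y : Xo x -> X y -> N (y - x) ^+ 2 / 2 <= V x y.
Proof.
move=> Xox Xy.
have core_growth z : relative_core X z -> N (z - x) ^+ 2 / 2 <= V x z.
  move=> zcore; apply/ler_addgt0Pr => e e0.
  have N0 : 0 <= N (z - x) ^+ 2 by rewrite exprn_ge0 // (is_norm_ge0 (pnormP ps)).
  (* enough bisections for N (z - x) ^+ 2 / 2 ^+ k to be below e *)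
  have := bregman_core_growth (Num.bound (N (z - x) ^+ 2 / e)) Xox zcore.
  set k := Num.bound _.
  have : N (z - x) ^+ 2 / e < 2 ^+ k.
    apply: (@lt_trans _ _ k%:R); first by rewrite archi_boundP // divr_ge0 // ltW.
    by rewrite -natrX ltr_nat ltn_expl.
  rewrite ltr_pdivrMr // => Ne.
  have : (2 ^+ k)^-1 * N (z - x) ^+ 2 <= e.
    by rewrite mulrC ler_pdivrMr ?exprn_gt0 // mulrC ltW // mulrC.
  lra.
have [w wcore] : relative_core X !=set0.
  by apply: relative_core_nonempty => //; exists y.
pose a := N (y - x); pose b := N (w - y).
(* Move from y towards a core point w by a fraction s: V grows by at most
   s (V x w - V x y) by convexity, and a^2 / 2 drops by at most s a b by the
   triangle inequality. *)
apply: (@ler_affine_limit _ _ _ (V x w - V x y + a * b)) => s s0 s1.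
have := core_growth _ (relative_core_segment X_convex wcore Xy s0 s1).
set z := y + _; set c := N (z - x) => cV.
have VzE : V x z <= V x y + s * (V x w - V x y).
  have := convex_function_segment (dgf_convex ps) Xy (proj1 wcore) (ltW s0) s1.
  rewrite /V /bregman -/z.
  have -> : z - x = (y - x) + s *: ((w - x) - (y - x)).
    by apply/rowP => i; rewrite !mxE; ring.
  by rewrite ipDr ipZr ipBr; lra.
have ac : a <= c + s * b.
  have -> : a = N ((z - x) + s *: (- (w - y))).
    by congr N; apply/rowP => i; rewrite !mxE; ring.
  apply: (le_trans (is_norm_triangle (pnormP ps) _ _)).
  rewrite lerD2l (is_norm_homog (pnormP ps)) gtr0_norm //.
  by rewrite (is_normN (pnormP ps)).
have a0 : 0 <= a by exact: (is_norm_ge0 (pnormP ps)).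
have := ler_wpM2l a0 ac; have := sqr_ge0 (a - c).
rewrite -/a; lra.
Qed.

(** The minimality of the prox point says that g(z) - xi is some subgradient of
omega there; [subgradient_sub_dgf] with h = 0 compares it with the selected
subgradient, and this is the usual variational inequality. *)
Lemma prox_three_point z xi y : Xo z -> X y ->
  V (prox ps z xi) y + V z (prox ps z xi) + ip xi (prox ps z xi - y) <= V z y.
Proof.
move=> Xoz Xy; have [Xoq [Xq qmin]] := proxP (p := ps) xi Xoz.
set q := prox ps z xi in Xoq Xq qmin *.
have zero_convex : convex_function X (fun=> 0 : R).
  by move=> t u v _ _; rewrite convRE !mulr0 addr0.
have q_sub : subgradient ip X (fun y => 0 + 1 * omega y) q (g z - xi).
  move=> u Xu; have := qmin u Xu; rewrite /bregman !add0r !mul1r !ipBr !ipBl; lra.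
have := subgradient_sub_dgf zero_convex ler01 Xoq q_sub Xy.
rewrite scale1r (bregman_split z q y) !ipBl !ipBr; lra.
Qed.

(** The displacement term <zeta, z - q> is paid for by V_z(q) >= |q - z|^2 / 2 and
Young's inequality. *)
Lemma prox_step z G gamma zeta y : Xo z -> X y -> 0 <= gamma ->
  (dual_norm ip N zeta <= G%:E)%E ->
  gamma * ip zeta (z - y) <=
    V z y - V (prox ps z (gamma *: zeta)) y + (gamma * G) ^+ 2 / 2.
Proof.
move=> Xoz Xy gamma0 zG.
have := prox_three_point (gamma *: zeta) Xoz Xy; rewrite ipZl.
set q := prox _ _ _; have [_ [Xq _]] := proxP (p := ps) (gamma *: zeta) Xoz.
have := bregman_growth Xoz Xq; rewrite -/q => Vq.
have := ler_wpM2l gamma0 (ip_le_dual_norm (pnormP ps) (z - q) zG).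
have -> : N (z - q) = N (q - z) by rewrite -(is_normN (pnormP ps)) opprB.
have -> : ip zeta (z - y) = ip zeta (z - q) + ip zeta (q - y).
  by rewrite -ipDr addrA subrK.
have := sqr_ge0 (N (q - z) - gamma * G); lra.
Qed.

(** [subgradient_sub_dgf] with h = f - alpha omega: the subgradient inequality of h
at x is the claim. *)
Lemma relative_strong_convexity_bound f alpha x y zeta :
  0 <= alpha -> convex_function X (fun y => f y - alpha * omega y) ->
  Xo x -> X y -> subgradient ip X f x zeta ->
  f x - f y <= ip zeta (x - y) - alpha * V x y.
Proof.
move=> alpha0 fcvx Xox Xy fx.
have fx' : subgradient ip X (fun y => (f y - alpha * omega y) + alpha * omega y) x zeta.
  by move=> u Xu; rewrite !subrK; exact: fx.
have := subgradient_sub_dgf fcvx alpha0 Xox fx' Xy.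
rewrite ipBl ipZl /V /bregman -[x - y]opprB ipNr; lra.
Qed.

End ProximalGeometry.

(** * Weighted telescoping *)

Section Telescoping.
Variable R : realType.
Implicit Types alpha G gamma theta : R.

Definition telescoping_weight alpha (T t : nat) : R :=
  alpha / (T%:R * (T%:R + 1)) * (t%:R * (t%:R - 1)).

(** The step size is the one for which theta / gamma is the next weight,
proportional to (t + 1) t, while subtracting theta * alpha from it leaves the
current weight, proportional to t (t - 1). *)
Lemma weighted_step_telescopes alpha G gamma theta (l V V' : R) (T t : nat) :
  (0 < T)%N -> 0 < alpha -> 0 < G ->
  theta = 2 * t%:R / (T%:R * (T%:R + 1)) ->
  gamma = 2 / (alpha * (t%:R + 1)) ->
  gamma * l <= V - V' + (gamma * G) ^+ 2 / 2 ->
  theta * (l - alpha * V) <=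
    (2 * G ^+ 2 / (alpha * (T%:R + 1))) / T%:R -
    (telescoping_weight alpha T t.+1 * V' - telescoping_weight alpha T t * V).
Proof.
move=> T_gt0 alpha_gt0 G_gt0 thetaE gammaE step.
rewrite /telescoping_weight -(natr1 t) addrK.
have T0 : 0 < T%:R :> R by rewrite ltr0n.
have t0 : 0 <= t%:R :> R by [].
move: (T%:R : R) (t%:R : R) T0 t0 thetaE gammaE => Tr tr T0 t0 thetaE gammaE.
have T10 : 0 < Tr + 1 by rewrite addr_gt0.
have t10 : 0 < tr + 1 by rewrite ltr_wpDl.
pose k := alpha / (Tr * (Tr + 1)); rewrite -/k.
have scale_ge0 : 0 <= k * ((tr + 1) * tr).
  by rewrite mulr_ge0 // ?divr_ge0 ?mulr_ge0 // ltW.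
have gradient_error : k * ((tr + 1) * tr) * ((gamma * G) ^+ 2 / 2) <=
    (2 * G ^+ 2 / (alpha * (Tr + 1))) / Tr.
  have -> : k * ((tr + 1) * tr) * ((gamma * G) ^+ 2 / 2) =
      (2 * G ^+ 2 / (alpha * (Tr + 1))) / Tr * (tr / (tr + 1)).
    by rewrite gammaE /k; field; rewrite !gt_eqF.
  rewrite ger_pMr ?divr_gt0 ?mulr_gt0 ?exprn_gt0 //.
  by rewrite ler_pdivrMr // mul1r lerDl.
have := ler_wpM2l scale_ge0 step.
have -> : k * ((tr + 1) * tr) * (gamma * l) = theta * l.
  by rewrite gammaE thetaE /k; field; rewrite !gt_eqF.
have -> : theta * (l - alpha * V) = theta * l - 2 * tr * k * V.
  by rewrite thetaE /k; field; rewrite !gt_eqF.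
lra.
Qed.

(** The upper bound M makes the supremum finite, which in turn makes the infimum
finite, so that the subtraction below is never one of infinities. *)
Lemma regret_le_gap (E : Type) (X : set E) (A M : R) (F B : E -> R) :
  X !=set0 -> (forall y, X y -> A - F y <= B y) -> (forall y, X y -> B y <= M) ->
  (A%:E - ereal_inf [set (F y)%:E | y in X] <=
     ereal_sup [set (B y)%:E | y in X])%E /\
  (ereal_sup [set (B y)%:E | y in X] <= M%:E)%E.
Proof.
move=> [c Xc] regret boundB.
set gap := ereal_sup _; set inf := ereal_inf _.
have gap_le : (gap <= M%:E)%E.
  by apply: ge_ereal_sup => _ [y Xy <-]; rewrite lee_fin boundB.
split=> //.
have gap_ge y : X y -> ((B y)%:E <= gap)%E.
  by move=> Xy; apply: ereal_sup_ubound; exists y.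
have gap_fin : gap \is a fin_num.
  rewrite fin_numElt (lt_le_trans (ltNyr _) (gap_ge _ Xc)) /=.
  exact: (le_lt_trans gap_le (ltry _)).
rewrite -(fineK gap_fin) in gap_ge *.
have inf_ge : ((A - fine gap)%:E <= inf)%E.
  apply/ereal_infP => _ [y Xy <-]; rewrite lee_fin.
  by have := gap_ge y Xy; rewrite lee_fin; have := regret y Xy; lra.
have inf_fin : inf \is a fin_num.
  rewrite fin_numElt (lt_le_trans (ltNyr _) inf_ge) /=.
  apply: (@le_lt_trans _ _ (F c)%:E); last exact: ltry.
  by apply: ge_ereal_inf; exists (F c)%:E => //; exists c.
rewrite -(fineK inf_fin) in inf_ge *.
by move: inf_ge; rewrite -EFinB !lee_fin; lra.
Qed.

End Telescoping.

(** * The regret bound *)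

Theorem theorem2 (R : realType) (n : nat) (ip : {dot 'rV[R]_n for (@idfun R)})
    (X : set 'rV[R]_n) (ps : proximal_setup ip X) (T : nat)
    (f : nat -> 'rV[R]_n -> R) (gradf : nat -> 'rV[R]_n -> 'rV[R]_n)
    (alpha G : R) (theta gamma : nat -> R) (x : nat -> 'rV[R]_n)
  (X_convex : convex_set X)
  (T_ge1 : (1 <= T)%N)
  (gradfP : forall t, (1 <= t <= T)%N -> forall y, X y ->
     subgradient ip X (f t) y (gradf t y))
  (alpha_gt0 : 0 < alpha)
  (f_strong : forall t, (1 <= t <= T)%N ->
     convex_function X (fun y => f t y - alpha * dgf ps y))
  (G_gt0 : 0 < G)
  (gradf_bound : forall t, (1 <= t <= T)%N -> forall y, X y ->
     (dual_norm ip (pnorm ps) (gradf t y) <= G%:E)%E)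
  (thetaE : forall t, (1 <= t <= T)%N ->
     theta t = 2 * t%:R / (T%:R * (T%:R + 1)))
  (gammaE : forall t, (1 <= t <= T)%N -> gamma t = 2 / (alpha * (t%:R + 1)))
  (x1E : x 1%N = dgf_center ps)
  (xSE : forall t, (1 <= t <= T)%N ->
     x t.+1 = prox ps (x t) (gamma t *: gradf t (x t))) :
  let gap :=
    ereal_sup [set (\sum_(1 <= t < T.+1)
      theta t * (ip (gradf t (x t)) (x t - y) - alpha * setup_bregman ps (x t) y))%:E
      | y in X] in
  ((\sum_(1 <= t < T.+1) theta t * f t (x t))%:E -
     ereal_inf [set (\sum_(1 <= t < T.+1) theta t * f t y)%:E | y in X]
   <= gap)%E /\
  (gap <= (2 * G ^+ 2 / (alpha * (T%:R + 1)))%:E)%E.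
Proof.
have Xc : X (dgf_center ps) by exact: (proj1 (dgf_centerP ps)).
have Xo_x t : (1 <= t <= T.+1)%N ->
    subdifferentiable_points ip X (dgf ps) (x t).
  elim: t => // -[_ _|t IHt tT].
    (* 0 is a subgradient at a minimizer *)
    rewrite x1E; split=> //; exists 0 => y Xy.
    by rewrite linear0l addr0; exact: (proj2 (dgf_centerP ps)).
  rewrite xSE; last by [].
  by apply: (proj1 (proxP _ _)); apply: IHt; rewrite /= ltnW.
have Xo_xT t : (1 <= t <= T)%N ->
    subdifferentiable_points ip X (dgf ps) (x t).
  by move=> /andP[t1 tT]; apply: Xo_x; rewrite t1 ltnW.
have T0 : 0 < T%:R :> R by rewrite ltr0n.
apply: regret_le_gap; first by exists (dgf_center ps).
- move=> y Xy; rewrite -sumrB; apply: ler_sum_nat => t tT.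
  rewrite -mulrBr ler_wpM2l //.
    by rewrite thetaE // divr_ge0 // mulr_ge0 // addr_ge0.
  apply: (relative_strong_convexity_bound X_convex (ltW alpha_gt0)) => //.
  + exact: f_strong.
  + exact: Xo_xT.
  + by apply: gradfP => //; exact: (proj1 (Xo_xT t tT)).
- move=> y Xy; pose V t := setup_bregman ps (x t) y.
  pose W t := telescoping_weight alpha T t * V t.
  have stepB t : (1 <= t < T.+1)%N ->
      theta t * (ip (gradf t (x t)) (x t - y) - alpha * V t) <=
      (2 * G ^+ 2 / (alpha * (T%:R + 1))) / T%:R - (W t.+1 - W t).
    move=> tT; have Xot := Xo_xT t tT.
    apply: (weighted_step_telescopes T_ge1 alpha_gt0 G_gt0 (thetaE t tT)
      (gammaE t tT)).
    have gamma_ge0 : 0 <= gamma t.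
      by rewrite gammaE // divr_ge0 // mulr_ge0 ?addr_ge0 // ltW.
    rewrite /V xSE //; apply: prox_step => //.
    exact: (gradf_bound t tT _ (proj1 Xot)).
  apply: (le_trans (ler_sum_nat stepB)).
  rewrite sumrB telescope_sumr // sumr_const_nat subSS subn0.
  rewrite -[X in X - _]mulr_natr mulfVK ?gt_eqF //.
  have -> : W 1%N = 0 by rewrite /W /telescoping_weight subrr !mulr0 mul0r.
  rewrite subr0 gerBl; apply: mulr_ge0; last first.
    by apply: bregman_ge0 => //; apply: Xo_x; rewrite /= leqnn.
  rewrite /telescoping_weight -(natr1 T) addrK.
  by rewrite mulr_ge0 ?divr_ge0 ?mulr_ge0 ?addr_ge0 // ltW.
Qed.
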